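(* Let $(X_t)_{t\ge1}$ be random variables in $[0,1]$ with average conditional means $(\mu_t)$, and let $(\widehat X_t)$ be a predictable sequence in $[0,1)$. Let $h:[0,\infty)\to(0,\infty)$ be nondecreasing with $\sum_{j=0}^\infty 1/h(j)\le1$. Fix $\eta>1$, $\alpha\in(0,1)$ and $L_0\ge1$, and let $V_t=\sum_{i\le t}\psi_E(|X_i-\widehat X_i|)$ and $\overline X_t=t^{-1}\sum_{i\le t}X_i$. Then, with probability at least $1-\alpha$, simultaneously for all $t\ge1$ such that $L_0\le V_t<\infty$ and $h(\log_\eta(V_t/L_0))\le\frac{\alpha}{2}\exp(V_t)$, we have \[ |\overline X_t-\mu_t|\le\frac{\sqrt\eta+1}{t}\sqrt{V_t\left(\log\frac{2}{\alpha}+\log h\Big(\log_\eta\frac{V_t}{L_0}\Big)\right)} . \]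
   Context: $\mathcal F_t=\sigma(X_1,\dots,X_t)$, and $\mathcal F_0$ is trivial. A sequence is predictable if its $t$-th term is $\mathcal F_{t-1}$-measurable. The average conditional mean is $\mu_t:=t^{-1}\sum_{j\le t}\mathbb{E}[X_j\mid\mathcal F_{j-1}]$. $\psi_E(x)=-\log(1-x)-x$ for $x\in[0,1)$, and $\psi_E(1):=+\infty$. *)

(* Defs.v *)
From HB Require Import structures.
From mathcomp Require Import all_boot all_order all_algebra.
From mathcomp Require Import all_classical all_reals all_analysis.
Set Implicit Arguments. Unset Strict Implicit. Unset Printing Implicit Defensive.
Import Order.TTheory GRing.Theory Num.Theory.
Local Open Scope classical_set_scope.
Local Open Scope ring_scope.

(* natural filtration: F_t = sigma(X_1, ..., X_t) (indices start at 1;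
   X 0 is never used). F_0 is the trivial sigma-algebra {set0, setT}. *)
Definition nat_filtration {d} {T : measurableType d} {R : realType}
  (X : nat -> T -> R) (t : nat) : set (set T) :=
  <<s [set A | exists i B, [/\ (1 <= i <= t)%N, measurable B & A = X i @^-1` B]] >>.

Definition measurable_wrt {d} {T : measurableType d} {R : realType}
  (G : set (set T)) (f : T -> R) : Prop :=
  forall B : set R, measurable B -> G (f @^-1` B).

Definition is_cond_exp {d} {T : measurableType d} {R : realType}
  (P : probability T R) (G : set (set T)) (Y m : T -> R) : Prop :=
  [/\ measurable_wrt G m, P.-integrable setT (fun x => (m x)%:E) &
      forall A, G A -> (\int[P]_(x in A) (m x)%:E = \int[P]_(x in A) (Y x)%:E)%E].

Definition psiE {R : realType} (x : R) : \bar R :=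
  if (0 <= x) && (x < 1) then (- ln (1 - x) - x)%:E else +oo%E.

Definition logb {R : realType} (eta x : R) : R := ln x / ln eta.

(* Main.v *)
(** For s in [-1,1] and y = X_t - Xhat_t one has
    exp (s y - s^2 psi_E |y|) <= 1 + s y, because psi_E (u) / u^2 is
    nondecreasing.  Taking conditional expectations and using 1 + z <= exp z,
    the process exp (s (sum_i (X_i - m_i)) - s^2 V_t) is dominated by the
    nonnegative supermartingale with factors
    (1 + s (X_i - Xhat_i)) exp (- s (m_i - Xhat_i)), so Ville's inequality
    controls all times at once.  The epoch V_t in [L0 eta^k, L0 eta^(k+1)) is
    treated with s = lam_k and s = - lam_k, where
    lam_k = min (1, sqrt (l_k / (L0 eta^k))) and l_k = log (2 h(k) / alpha),
    at the cost of probability alpha / h(k), and these costs sum to at most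
    alpha. *)
Require Import Defs.
From HB Require Import structures.
From mathcomp Require Import all_boot all_order all_algebra.
From mathcomp Require Import all_classical all_reals all_analysis.
From mathcomp Require Import measurable_realfun measurable_fun_approximation.
From mathcomp Require Import ring lra.
Set Implicit Arguments. Unset Strict Implicit. Unset Printing Implicit Defensive.
Import Order.TTheory GRing.Theory Num.Theory.
Import numFieldNormedType.Exports HBNNSimple.
Local Open Scope classical_set_scope.
Local Open Scope ring_scope.

(** * Conditional expectations, and the scalar inequality for [psi_E] *)

Lemma nonneg_bounded_integrable d (T : measurableType d) (R : realType)
    (P : probability T R) (f : T -> R) (C : R) :
    measurable_fun setT f -> (forall x, 0 <= f x <= C) ->
  P.-integrable setT (EFin \o f).
Proof.
move=> mf f0C; apply: measurable_bounded_integrable => //.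
  by rewrite -ge0_fin_numE// fin_num_measure.
exists C; split=> [|M ltM x _ /=]; first exact: num_real.
by have /andP[f0 fC] := f0C x; rewrite ger0_norm// (le_trans fC)// ltW.
Qed.

Lemma sub_sigma_measurable_fun d (T : measurableType d) (R : realType)
    (G : set (set T)) (f : T -> R) :
    (<<s G >> `<=` measurable) ->
  measurable_fun setT (f : g_sigma_algebraType G -> R) -> measurable_fun setT f.
Proof. by move=> GT mf _ B mB; apply: GT; exact: mf. Qed.

(** The residual [Y - m] integrates to 0 over every set of the sub-sigma-algebra, hence against its
    simple functions; bounded measurable [H] follow by dominated convergence. This is the
    martingale-difference property used for the wealth. *)
Lemma integral_mul_cond_exp_resid d (T : measurableType d) (R : realType)
    (P : probability T R) (G : set (set T)) (Y m H : T -> R) (C : R) :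
    (<<s G >> `<=` measurable) ->
    P.-integrable setT (EFin \o Y) -> is_cond_exp P <<s G >> Y m ->
    measurable_fun setT (H : g_sigma_algebraType G -> R) ->
    (forall x, 0 <= H x <= C) ->
  (\int[P]_x (H x * (Y x - m x))%:E = 0)%E.
Proof.
move=> GT iY [mm im mY] mH H0C.
pose D x := Y x - m x.
have iD : P.-integrable setT (EFin \o D).
  have -> : EFin \o D = ((EFin \o Y) \- (EFin \o m))%E by [].
  exact: integrableB.
have mD : measurable_fun setT D by apply/measurable_EFinP; exact: measurable_int iD.
have intD A : <<s G >> A -> (\int[P]_(x in A) (D x)%:E = 0)%E.
  move=> GA; have mA := GT _ GA.
  have iYA : P.-integrable A (EFin \o Y) by exact: integrableS iY.
  have imA : P.-integrable A (EFin \o m) by exact: integrableS im.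
  under eq_integral do rewrite EFinB.
  rewrite integralB//= mY// subee//.
  by apply: integrable_fin_num => //; exact: GT.
have mHE : measurable_fun setT (EFin \o H : g_sigma_algebraType G -> \bar R).
  exact/measurable_EFinP.
(* The approximation is taken on the space generated by [G], so that the level sets of each [g n]
   belong to [<<s G>>]. *)
pose g := nnsfun_approx measurableT mHE.
have gH x : EFin \o g^~ x @ \oo --> (H x)%:E.
  apply: (@cvg_nnsfun_approx _ _ _ _ measurableT _ mHE) => // y _.
  by rewrite lee_fin; case/andP: (H0C y).
have gle n x : g n x <= H x.
  rewrite -lee_fin /g nnsfun_approxE.
  apply: (@le_approx _ (g_sigma_algebraType G) R setT (EFin \o H)) => // y _.
  by rewrite lee_fin; case/andP: (H0C y).
have mg n (A : set R) : measurable A -> <<s G >> (g n @^-1` A).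
  move=> mA; have mgn : measurable_fun setT (g n) by [].
  by have := mgn measurableT A mA; rewrite setTI.
have mgT n : measurable_fun setT (g n : T -> R).
  by move=> _ B mB; rewrite setTI; apply: GT; exact: mg.
have intg n : (\int[P]_x (g n x * D x)%:E = 0)%E.
  pose A y : set T := g n @^-1` [set y].
  have mA y : <<s G >> (A y) by exact: mg.
  have iA y : P.-integrable setT (fun x => (\1_(A y) x * D x)%:E).
    have -> : (fun x => (\1_(A y) x * D x)%:E) =
        ((EFin \o \1_(A y)) \* (EFin \o D))%E.
      by apply/funext => x; rewrite /= EFinM.
    apply: integrableMr => //; first by apply: measurable_indic; exact: GT.
    exists 1; split=> // M M1 x _.
    by rewrite /= ger0_norm// (le_trans _ (ltW M1))// indicE lern1 leq_b1.
  (* Split the simple function along its level sets; [intD] kills each term. *)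
  transitivity (\int[P]_x (\sum_(y <- finmap.enum_fset (fset_set (range (g n))))
      (y * (\1_(A y) x * D x))%:E)%E)%E.
    apply: eq_integral => x _; rewrite sumEFin; congr EFin.
    rewrite fimfunE fsbig_finite//= mulr_suml.
    by apply: eq_bigr => y _; rewrite mulrA.
  rewrite integral_sum//=; last first.
    by move=> y; under eq_fun do rewrite EFinM; exact: integrableZl.
  rewrite big1_seq// => y _.
  under eq_integral do rewrite EFinM.
  rewrite integralZl//.
  under eq_integral => x _ do rewrite mulrC EFinM.
  rewrite -[X in (_ * X)%E](_ : (\int[P]_x ((EFin \o D) \_ (A y)) x = _)%E).
    by rewrite -integral_mkcond intD ?mule0.
  by apply: eq_integral => x _; rewrite epatch_indic.
have mHT : measurable_fun setT H by exact: sub_sigma_measurable_fun mH.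
have [|||||_ _] := @dominated_convergence _ _ _ P _ measurableT
  (fun n x => (g n x * D x)%:E) (fun x => (H x * D x)%:E)
  (fun x => C%:E * (`|D x|)%:E)%E.
- by move=> n; apply/measurable_EFinP; exact: measurable_funM.
- by apply/measurable_EFinP; exact: measurable_funM.
- apply: aeW => x _; under eq_fun do rewrite EFinM.
  by rewrite EFinM; apply: cvgeZr => //; exact: gH.
- by apply: integrableZl => //; exact: integrable_abse iD.
- apply: aeW => x n _; rewrite abse_EFin -EFinM lee_fin normrM ler_wpM2r//.
  have g0 : 0 <= g n x by exact: fun_ge0.
  by rewrite ger0_norm// (le_trans (gle n x))//; case/andP: (H0C x).
under eq_fun do rewrite intg.
by move/(cvg_lim (@ereal_hausdorff _)); rewrite lim_cst//; exact: ereal_hausdorff.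
Qed.

(* [s ^+ 2 * psi_E u - s * u + ln (1 + s * u)] vanishes at [0] and has
   derivative [s ^+ 2 * u * ((1 - u)^-1 - (1 + s * u)^-1) >= 0]. *)
Lemma expR_psi_le (R : realType) (s a : R) : -1 <= s <= 1 -> 0 <= a < 1 ->
  expR (s * a - s ^+ 2 * (- ln (1 - a) - a)) <= 1 + s * a.
Proof.
move=> /andP[s1 s2] /andP[a0 a1].
have sq0 : 0 <= s ^+ 2 by rewrite sqr_ge0.
have pos (u : R) : 0 <= u <= a -> 0 < 1 - u /\ 0 < 1 + s * u.
  move=> /andP[u0 ua]; split; first by lra.
  by nra.
pose g u : R := s ^+ 2 * (- ln (1 - u) - u) - s * u + ln (1 + s * u).
have dg u : 0 <= u <= a ->
    is_derive u 1 g (s ^+ 2 * u * ((1 - u)^-1 - (1 + s * u)^-1)).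
  move=> /pos[p1 p2].
  have d1 : is_derive (1 - u) 1 (@ln R) (1 - u)^-1 by exact: is_derive1_ln.
  have d2 : is_derive (1 + s * u) 1 (@ln R) (1 + s * u)^-1 by exact: is_derive1_ln.
  have d3 : is_derive u 1 (fun u => 1 - u : R) (-1).
    by apply: is_derive_eq; rewrite add0r mul1r.
  have d4 : is_derive u 1 (fun u => 1 + s * u : R) s.
    by apply: is_derive_eq; rewrite add0r mul1r; exact: mulr1. 
  have d5 : is_derive u 1 (fun u => ln (1 - u)) ((1 - u)^-1 * -1) :=
    @is_derive1_comp R (@ln R) (fun u => 1 - u) u _ _ d1 d3.
  have d6 : is_derive u 1 (fun u => ln (1 + s * u)) ((1 + s * u)^-1 * s) :=
    @is_derive1_comp R (@ln R) (fun u => 1 + s * u) u _ _ d2 d4.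
  rewrite /g; apply: is_derive_eq.
  rewrite /= (_ : s%:A = s); last exact: mulr1.
  rewrite (_ : forall v w : R, v *: w = v * w)//.
  by field; rewrite !gt_eqF.
have : g 0 <= g a.
  apply: (@ger0_derive1_le_cc _ g 0 a).
  - move=> u; rewrite in_itv/= => /andP[u0 ua].
    by have [] := dg u; first by rewrite !ltW.
  - move=> u; rewrite in_itv/= => /andP[u0 ua].
    have ua' : 0 <= u <= a by rewrite !ltW.
    have [p1 p2] := pos _ ua'.
    rewrite derive1E; have [_ ->] := dg u ua'.
    apply: mulr_ge0; first by rewrite mulr_ge0// ltW.
    (* The derivative is nonnegative because [-1 <= s] and [0 <= u] give [1 - u <= 1 + s * u]. *)
    rewrite subr_ge0 lef_pV2 ?posrE//.
    by nra.
  - apply: derivable_within_continuous => u; rewrite in_itv/= => ua.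
    by have [] := dg u.
  - by rewrite in_itv/= lexx.
  - by rewrite in_itv/= a0 lexx.
  - exact: a0.
rewrite /g !mulr0 !subr0 addr0 ln1 oppr0 mulr0 add0r => ga.
have [_ p2] := pos a (ltac:(by rewrite a0 lexx)).
rewrite -[leRHS]lnK ?posrE// ler_expR; lra.
Qed.

(** The sets where [m < 0] and where [1 < m] lie in the sub-sigma-algebra, so [m] may be replaced by
    [Y] when integrating over them; the bounds on [Y] then force both sets to be null. Only an
    almost sure statement is possible, since [m] is an arbitrary version. *)
Lemma cond_exp_ge0_le1 d (T : measurableType d) (R : realType)
    (P : probability T R) (G : set (set T)) (Y m : T -> R) :
    (<<s G >> `<=` measurable) ->
    measurable_fun setT Y -> (forall x, 0 <= Y x <= 1) ->
    is_cond_exp P <<s G >> Y m ->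
  {ae P, forall x, 0 <= m x <= 1}.
Proof.
move=> GT mY Y01 [mm im mYm].
have mT : measurable_fun setT m by apply/measurable_EFinP; exact: measurable_int im.
have neg0 (f : T -> R) (A : set T) : measurable_fun setT f ->
    A = [set x | 0 < f x] -> measurable A ->
    (\int[P]_(x in A) (f x)%:E <= 0)%E -> P A = 0%E.
  move=> mf -> mA f0.
  have mfA : measurable_fun [set x | 0 < f x] (EFin \o f).
    by apply/measurable_EFinP; exact: measurable_funTS.
  have /(ae_eq_integral_abs P mA mfA)[N [mN N0 AN]] :
      (\int[P]_(x in [set x | (0 < f x)%R]) `|(f x)%:E| = 0)%E.
    apply/eqP; rewrite eq_le integral_ge0 ?andbT//.
    apply: le_trans f0; rewrite le_eqVlt; apply/orP; left; apply/eqP.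
    by apply: eq_integral => x /[!inE]/= fx0; rewrite gtr0_norm.
  apply/eqP; rewrite eq_le measure_ge0 andbT -N0 le_measure ?inE//.
  apply: subset_trans AN => x /= fx0 /(_ fx0)[] fx.
  by rewrite fx ltxx in fx0.
have iY := nonneg_bounded_integrable P mY Y01.
have measurable_lo : <<s G >> [set x | 0 < - m x].
  rewrite (_ : [set _ | _] = m @^-1` `]-oo, 0[); first exact: mm.
  by apply/seteqP; split => x /=; rewrite in_itv/= oppr_gt0.
have measurable_hi : <<s G >> [set x | 0 < m x - 1].
  rewrite (_ : [set _ | _] = m @^-1` `]1, +oo[); first exact: mm.
  by apply/seteqP; split => x /=; rewrite in_itv/= andbT subr_gt0.
have lo : P [set x | 0 < - m x] = 0%E.
  have mA := GT _ measurable_lo.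
  apply: (neg0 _ _ _ erefl) => //; first exact: measurable_funN.
  under eq_integral do rewrite EFinN.
  rewrite integralN/=; last by apply: integrable_add_def; [|exact: integrableS im].
  rewrite mYm// leeNl oppe0; apply: integral_ge0 => x _.
  by rewrite lee_fin; case/andP: (Y01 x).
have hi : P [set x | 0 < m x - 1] = 0%E.
  have mA := GT _ measurable_hi.
  apply: (neg0 _ _ _ erefl) => //; first exact: measurable_funB.
  under eq_integral do rewrite EFinB.
  rewrite integralB//=; last 2 first.
  - exact: integrableS im.
  - exact: finite_measure_integrable_cst.
  rewrite mYm// sube_le0; apply: le_integral => //.
  - exact: integrableS iY.
  - exact: finite_measure_integrable_cst.
  - by move=> x _; rewrite lee_fin; case/andP: (Y01 x).
apply: (@negligibleS _ _ _ _ ([set x | 0 < - m x] `|` [set x | 0 < m x - 1])).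
  move=> x /= /negP; rewrite negb_and -!ltNge oppr_gt0 subr_gt0.
  by case/orP; [left|right].
by apply: negligibleU; apply/negligibleP => //; exact: GT.
Qed.

(** * The natural filtration as a family of measurable spaces *)

(** Naming the generators lets measurability with respect to [nat_filtration X t] be expressed as
    ordinary [measurable_fun] on a generated space. *)
Definition nat_filtration_gen {d} {T : measurableType d} {R : realType}
    (X : nat -> T -> R) (t : nat) : set (set T) :=
  [set A | exists i B, [/\ (1 <= i <= t)%N, measurable B & A = X i @^-1` B]].

Notation filtrationType X t := (g_sigma_algebraType (nat_filtration_gen X t)).

Lemma nat_filtrationS d (T : measurableType d) (R : realType)
    (X : nat -> T -> R) (t : nat) :
  nat_filtration X t `<=` nat_filtration X t.+1.
Proof.
apply: sub_sigma_algebra2 => A [i [B [/andP[i1 it] mB ->]]].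
by exists i, B; split => //; rewrite i1 ltnW.
Qed.

Lemma nat_filtration_measurable d (T : measurableType d) (R : realType)
    (X : nat -> T -> R) (t : nat) :
    (forall i, (1 <= i)%N -> measurable_fun setT (X i)) ->
  nat_filtration X t `<=` measurable.
Proof.
move=> mX; apply: smallest_sub; first exact: sigma_algebra_measurable.
move=> A [i [B [/andP[i1 _] mB ->]]].
by rewrite -[X in measurable X]setTI; exact: mX.
Qed.

Lemma filtration_measurableS d (T : measurableType d) (R : realType)
    (X : nat -> T -> R) (t : nat) (f : T -> R) :
  measurable_fun setT (f : filtrationType X t -> R) ->
  measurable_fun setT (f : filtrationType X t.+1 -> R).
Proof. by move=> mf _ B mB; apply: nat_filtrationS; exact: mf. Qed.

Lemma filtration_measurable_fun d (T : measurableType d) (R : realType)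
    (X : nat -> T -> R) (t : nat) (f : T -> R) :
  measurable_wrt (nat_filtration X t) f ->
  measurable_fun setT (f : filtrationType X t -> R).
Proof. by move=> mf _ B mB; rewrite setTI; exact: mf. Qed.

Lemma filtration_measurable_obs d (T : measurableType d) (R : realType)
    (X : nat -> T -> R) (t : nat) :
  measurable_fun setT (X t.+1 : filtrationType X t.+1 -> R).
Proof.
apply: filtration_measurable_fun => B mB.
by apply: sub_sigma_algebra; exists t.+1, B; rewrite leqnn.
Qed.

(** * The stopped wealth process and Ville's inequality *)

(** If [x] has conditional mean [mu] and [z = s * (mu - xh)], the factor has conditional mean
    [(1 + z) * expR (- z) <= 1]. *)
Definition bet {R : realType} (s x mu xh : R) : R :=
  (1 + s * (x - xh)) * expR (- (s * (mu - xh))).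

(* The product of the first [t] bets, stopped as soon as it reaches [c] or the
   next conditional mean leaves [0,1]; stopping keeps every factor bounded. *)
Fixpoint wealth {T : Type} {R : realType} (X m Xh : nat -> T -> R) (s c : R)
    (t : nat) (w : T) : R :=
  if t is u.+1 then
    if (wealth X m Xh s c u w < c) && (0 <= m u.+1 w <= 1)
    then wealth X m Xh s c u w * bet s (X u.+1 w) (m u.+1 w) (Xh u.+1 w)
    else wealth X m Xh s c u w
  else 1.

Section wealth_supermartingale.
Context d (T : measurableType d) (R : realType) (P : probability T R).
Context (X m Xh : nat -> T -> R) (s c : R).
Hypothesis mX : forall i, (1 <= i)%N -> measurable_fun setT (X i).
Hypothesis X01 : forall i x, (1 <= i)%N -> 0 <= X i x <= 1.
Hypothesis Xm : forall j, (1 <= j)%N ->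
  is_cond_exp P (nat_filtration X j.-1) (X j) (m j).
Hypothesis mXh : forall t, (1 <= t)%N ->
  measurable_wrt (nat_filtration X t.-1) (Xh t).
Hypothesis Xh01 : forall t x, (1 <= t)%N -> 0 <= Xh t x < 1.
Hypothesis s1 : -1 <= s <= 1.
Hypothesis c0 : 0 < c.

Let W := wealth X m Xh s c.

Let bet_itv t w : 0 <= 1 + s * (X t.+1 w - Xh t.+1 w) <= 2.
Proof.
have := X01 w (ltn0Sn t); have := Xh01 w (ltn0Sn t); move: s1.
by move=> /andP[? ?] /andP[? ?] /andP[? ?]; nra.
Qed.

Let bet_exp_itv t w : 0 <= m t.+1 w <= 1 ->
  0 <= expR (- (s * (m t.+1 w - Xh t.+1 w))) <= expR 1.
Proof.
move=> /andP[? ?]; rewrite expR_ge0 ler_expR /=.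
have := Xh01 w (ltn0Sn t); move: s1.
by move=> /andP[? ?] /andP[? ?]; nra.
Qed.

(** A bet is placed only from wealth below [c] and multiplies it by at most [2 * expR 1]; the
    summand 1 covers the initial wealth. *)
Let wealth_itv t w : 0 <= W t w <= 1 + c * (2 * expR 1).
Proof.
have e0 : 0 < expR 1 :> R := expR_gt0 1.
elim: t => [|t /andP[IH0 IH1]]; rewrite /W /= -/(W _ _).
  by rewrite ler01 lerDl !mulr_ge0// ltW.
case: ifPn => [/andP[Wc m01]|_]; last by rewrite IH0 IH1.
have /andP[b0 b2] := bet_itv t w; have /andP[e1 e2] := bet_exp_itv m01.
rewrite !mulr_ge0//= (@le_trans _ _ (c * (2 * expR 1)))// ?lerDr//.
by rewrite ler_pM ?mulr_ge0 ?(ltW Wc)// ler_pM.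
Qed.

Lemma measurable_wealth t :
  measurable_fun setT (W t : filtrationType X t -> R).
Proof.
elim: t => [|t IH]; first exact: measurable_cst.
have mW : measurable_fun setT (W t : filtrationType X t.+1 -> R).
  exact: filtration_measurableS.
have [mm0 _ _] := Xm (ltn0Sn t).
have mm := filtration_measurableS (filtration_measurable_fun mm0).
have mh := filtration_measurableS (filtration_measurable_fun (mXh (ltn0Sn t))).
rewrite /W /=; apply: measurable_fun_ifT => //.
- apply: measurable_and; first exact: measurable_fun_ltr.
  by apply: measurable_and; exact: measurable_fun_ler.
- apply: measurable_funM => //; apply: measurable_funM.
    apply: measurable_funD => //; apply: measurable_funM => //.
    by apply: measurable_funB => //; exact: filtration_measurable_obs.
  apply: measurableT_comp => //; apply: measurableT_comp => //.
  by apply: measurable_funM => //; exact: measurable_funB.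
Qed.

Let measurable_wealthT t : measurable_fun setT (W t).
Proof.
apply: (@sub_sigma_measurable_fun _ _ _ (nat_filtration_gen X t)).
  exact: nat_filtration_measurable.
exact: measurable_wealth.
Qed.

Let integrable_wealth t : P.-integrable setT (EFin \o W t).
Proof.
exact: nonneg_bounded_integrable (measurable_wealthT t) (wealth_itv t).
Qed.

(** One step adds at most [s] times a bounded predictable coefficient times [X t.+1 - m t.+1], which
    integrates to 0, so the expectation never increases. *)
Lemma integral_wealth_le1 t : (\int[P]_w (W t w)%:E <= 1)%E.
Proof.
elim: t => [|t IH].
  by rewrite /W/= integral_cst//= mul1e probability_setT.
pose active w := (W t w < c) && (0 <= m t.+1 w <= 1).
(* The predictable coefficient of the residual in the next wealth; it vanishes once the process is
   frozen. *)
pose H w := if active w then W t w * expR (- (s * (m t.+1 w - Xh t.+1 w))) else 0.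
have [mm0 im _] := Xm (ltn0Sn t).
have FT := @nat_filtration_measurable _ _ _ X t mX.
have mH : measurable_fun setT (H : filtrationType X t -> R).
  have mW := @measurable_wealth t.
  have mm := filtration_measurable_fun mm0.
  have mh := filtration_measurable_fun (mXh (ltn0Sn t)).
  apply: measurable_fun_ifT => //.
    apply: measurable_and; first exact: measurable_fun_ltr.
    by apply: measurable_and; exact: measurable_fun_ler.
  apply: measurable_funM => //.
  apply: measurableT_comp => //; apply: measurableT_comp => //.
  by apply: measurable_funM => //; exact: measurable_funB.
have HC w : 0 <= H w <= c * expR 1.
  rewrite /H; case: ifPn => [/andP[Wc m01]|_].
    have /andP[W0 _] := wealth_itv t w; have /andP[e1 e2] := bet_exp_itv m01.
    by rewrite mulr_ge0//= ler_pM// ltW.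
  by rewrite lexx mulr_ge0 ?expR_ge0// ltW.
have iX : P.-integrable setT (EFin \o X t.+1).
  by apply: (@nonneg_bounded_integrable _ _ _ _ _ 1) => [|w]; [exact: mX|exact: X01].
have H0 := integral_mul_cond_exp_resid FT iX (Xm (ltn0Sn t)) mH HC.
have iHD : P.-integrable setT (fun w => (H w * (X t.+1 w - m t.+1 w))%:E).
  have -> : (fun w => (H w * (X t.+1 w - m t.+1 w))%:E) =
      ((EFin \o H) \* ((EFin \o X t.+1) \- (EFin \o m t.+1)))%E.
    by apply/funext => w; rewrite /= EFinM EFinB.
  apply: integrableMr => //; last exact: integrableB.
    exact: (@sub_sigma_measurable_fun _ _ _ (nat_filtration_gen X t)).
  exists (c * expR 1); split=> [|M ltM w _ /=]; first exact: num_real.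
  by have /andP[? ?] := HC w; rewrite ger0_norm// (le_trans _ (ltW ltM)).
apply: (@le_trans _ _ (\int[P]_w ((W t w)%:E +
    s%:E * (H w * (X t.+1 w - m t.+1 w))%:E))%E); last first.
  rewrite integralD//=; [|exact: integrable_wealth|exact: integrableZl].
  by rewrite integralZl// H0 mule0 adde0.
apply: le_integral => //.
- exact: integrable_wealth.
- by apply: integrableD => //; [exact: integrable_wealth|exact: integrableZl].
(* pointwise domination, from [(1 + z) * exp (- z) <= 1] *)
move=> w _; rewrite -EFinM -EFinD lee_fin {1}/W /= -/(W _ _) /H /active.
case: ifPn => [/andP[Wc m01]|_]; last by rewrite mul0r mulr0 addr0.
have /andP[W0 _] := wealth_itv t w; rewrite /bet.
set z := s * (m t.+1 w - Xh t.+1 w).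
have : (1 + z) * expR (- z) <= 1.
  by rewrite expRN ler_pdivrMr ?expR_gt0// mul1r expR_ge1Dx.
move=> /(ler_wpM2l W0); rewrite mulr1 => le1.
apply: le_trans (_ : _ <= W t w * ((1 + z) * expR (- z)) +
  s * (W t w * expR (- z) * (X t.+1 w - m t.+1 w))) _; last by rewrite lerD2r.
by rewrite le_eqVlt; apply/orP; left; apply/eqP; rewrite /z; ring.
Qed.

Lemma measurable_wealth_ge t : measurable [set w | c <= W t w].
Proof.
rewrite (_ : [set _ | _] = W t @^-1` `[c, +oo[).
  by rewrite -[X in measurable X]setTI; exact: measurable_wealthT.
by apply/seteqP; split => w /=; rewrite in_itv/= andbT.
Qed.

(** Wealth is frozen on reaching [c], so the events [c <= W t] increase with [t]. Markov's
    inequality bounds each of them, and continuity from below passes to the union. *)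
Lemma ville_wealth : (P (\bigcup_t [set w | (c <= W t w)%R]) <= (c^-1)%:E)%E.
Proof.
pose F t := [set w | c <= W t w].
have mF t : measurable (F t) by exact: measurable_wealth_ge.
have ndF : {homo F : n k / (n <= k)%N >-> (n <= k)%O}.
  apply: homo_leq => [A|B A C AB BC|t]; [exact: lexx|exact: le_trans AB BC|].
  rewrite subsetEset => w; rewrite /F/= => cW.
  by rewrite /W /= -/(W _ _) ltNge cW.
have cvgF := @nondecreasing_cvg_mu _ _ _ P F mF
  (bigcup_measurable (fun k _ => mF k)) ndF.
rewrite -(cvg_lim (@ereal_hausdorff _) cvgF); apply: lime_le.
  by apply/cvg_ex; eexists; exact: cvgF.
apply: nearW => t /=.
have mWE : measurable_fun setT (EFin \o W t).
  by apply/measurable_EFinP; exact: measurable_wealthT.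
have := le_integral_abse P measurableT mWE c0.
rewrite setTI (_ : [set _ | _] = F t); last first.
  apply/seteqP; split => w; rewrite /F /= lee_fin;
  by have /andP[W0 _] := wealth_itv t w; rewrite ger0_norm.
under eq_integral => w _ do rewrite /= ger0_norm ?(andP (wealth_itv t w)).1//.
move=> /le_trans/(_ (integral_wealth_le1 t)).
by rewrite -[(c^-1)%:E]mule1 lee_pdivlMl.
Qed.

End wealth_supermartingale.

(** * From bounded wealth to deviation bounds within an epoch *)

Lemma wealth_prod (T : Type) (R : realType) (X m Xh : nat -> T -> R) (s c : R)
    (w : T) (t : nat) :
    (forall j, 0 <= m j.+1 w <= 1) -> (forall u, wealth X m Xh s c u w < c) ->
  wealth X m Xh s c t w =
  \prod_(1 <= i < t.+1) bet s (X i w) (m i w) (Xh i w).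
Proof.
move=> m01 Wc; elim: t => [|t IH]; first by rewrite big_geq.
by rewrite /= Wc m01 big_nat_recr//= -IH.
Qed.

Lemma psiE_gtNy (R : realType) (x : R) : (-oo < psiE x)%E.
Proof. by rewrite /psiE; case: ifP => _; rewrite ?ltNyr. Qed.

(** Writing [x - mu] as [(x - xh) - (mu - xh)] isolates the exponential factor of the bet. What
    remains is [expR_psi_le] at [|x - xh|], with [s] replaced by [- s] when [x < xh]. *)
Lemma bet_ge (R : realType) (s x mu xh : R) :
    -1 <= s <= 1 -> (psiE `|x - xh|%R < +oo)%E ->
  expR (s * (x - mu) - s ^+ 2 * fine (psiE `|x - xh|)) <= bet s x mu xh.
Proof.
move=> s1; rewrite /psiE; case: ifPn => [a01 _|]; last by rewrite ltxx.
have -> : s * (x - mu) = s * (x - xh) - s * (mu - xh) by ring.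
rewrite /bet [fine _]/=.
rewrite addrAC expRD ler_wpM2r ?expR_ge0//.
have [xy|xy] := leP 0 (x - xh).
  by move: a01; rewrite ger0_norm//; exact: expR_psi_le.
move: a01; rewrite ltr0_norm// => /(@expR_psi_le _ (- s)).
by rewrite sqrrN mulrNN; apply; lra.
Qed.

Lemma prod_bet_ge (R : realType) (s : R) (x mu xh : nat -> R) (t : nat) :
    -1 <= s <= 1 ->
    (\sum_(1 <= i < t.+1) psiE `|x i - xh i|%R < +oo)%E ->
  expR (s * \sum_(1 <= i < t.+1) (x i - mu i) -
        s ^+ 2 * fine (\sum_(1 <= i < t.+1) psiE `|x i - xh i|%R)%E) <=
  \prod_(1 <= i < t.+1) bet s (x i) (mu i) (xh i).
Proof.
move=> s1; elim: t => [|t IH].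
  by rewrite !big_geq//= !mulr0 subr0 expR0.
rewrite !(@big_nat_recr _ _ _ t.+1 1)//= => Voo.
set V := (\sum_(1 <= i < t.+1) _)%E in IH Voo *.
have VNy : (-oo < V)%E.
  rewrite ltNye; apply/negP => /eqP/esum_eqNyP[i [_ _ psiNy]].
  by have := psiE_gtNy `|x i - xh i|; rewrite psiNy ltxx.
(* Neither summand is [-oo], so a finite sum forces both to be finite. *)
have [V1 V2] : (V < +oo)%E /\ (psiE `|x t.+1 - xh t.+1|%R < +oo)%E.
  have pNy := psiE_gtNy `|x t.+1 - xh t.+1|.
  by move: Voo VNy pNy; case: V {IH} => [r||]; case: (psiE _).
rewrite fineD ?fin_numE -?ltNye -?ltey ?V1 ?V2 ?VNy ?psiE_gtNy//.
rewrite !mulrDr opprD addrACA expRD ler_pM ?expR_ge0//; first exact: IH.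
by rewrite -mulrDr; apply: (bet_ge _ s1 V2).
Qed.

(* The summand [1] next to [sqrt eta] pays for clipping [lam] at [1]: if [q <= l]
   then [v <= sqrt eta * sqrt (v * l)] and [l <= sqrt (v * l)]. *)
Lemma stitched_bound (R : realType) (S v q eta l : R) :
    0 < q -> q <= v <= eta * q -> 0 < l <= v ->
    let lam := Num.min 1 (Num.sqrt (l / q)) in
    lam * S - lam ^+ 2 * v <= l ->
  S <= (Num.sqrt eta + 1) * Num.sqrt (v * l).
Proof.
move=> q0 /andP[qv veq] /andP[l0 lv] lam.
have v0 : 0 < v by exact: lt_le_trans qv.
have eta0 : 0 <= eta by rewrite -(pmulr_lge0 _ q0); lra.
have slE : Num.sqrt l ^+ 2 = l by rewrite sqr_sqrtr// ltW.
have svE : Num.sqrt v ^+ 2 = v by rewrite sqr_sqrtr// ltW.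
have sveq : Num.sqrt v <= Num.sqrt eta * Num.sqrt q.
  by rewrite -sqrtrM// ler_sqrt// mulr_ge0// ltW.
have slv : Num.sqrt l <= Num.sqrt v by rewrite ler_sqrt// ltW.
have sqv : Num.sqrt q <= Num.sqrt v by rewrite ler_sqrt// ltW.
have [sq0 sl0 sv0] : [/\ 0 < Num.sqrt q, 0 < Num.sqrt l & 0 < Num.sqrt v].
  by rewrite !sqrtr_gt0.
have se0 : 0 <= Num.sqrt eta by exact: sqrtr_ge0.
rewrite sqrtrM ?(ltW v0)// {}/lam sqrtrM ?(ltW l0)// sqrtrV ?(ltW q0)//.
move: (Num.sqrt q) (Num.sqrt l) (Num.sqrt v) (Num.sqrt eta)
  slE svE sveq slv sqv sq0 sl0 sv0 se0 => a b u e lE vE uea bu au a0 b0 u0 e0.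
rewrite -{}lE -{}vE; case: (leP 1 (b / a)) => [|_].
  rewrite ler_pdivlMr// mul1r => ab Hle.
  have ueb : u * u <= e * b * u.
    by rewrite ler_pM2r// (le_trans uea)// ler_wpM2l.
  have bbu : b * b <= b * u by rewrite ler_pM2l.
  by lra.
(* Unclipped case: [r] is [lam] and [l = r ^+ 2 * a ^+ 2], so dividing the hypothesis by [r] leaves
   two terms, bounded by [e * b * u] and [b * u]. *)
set r := b / a; have r0 : 0 < r by rewrite divr_gt0.
have -> : b = r * a by rewrite /r divfK// gt_eqF.
move=> Hle.
have {}Hle : S <= r * u ^+ 2 + r * a ^+ 2.
  rewrite -(ler_pM2l r0); lra.
have ueb : r * u * u <= r * u * (e * a) by rewrite ler_wpM2l// mulr_ge0// ltW.
have bbu : r * a * a <= r * a * u by rewrite ler_wpM2l// mulr_ge0// ltW.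
by lra.
Qed.

Lemma wealth_deviation (T : Type) (R : realType) (X m Xh : nat -> T -> R)
    (s c : R) (w : T) (t : nat) :
    -1 <= s <= 1 -> 0 < c ->
    (forall j, 0 <= m j.+1 w <= 1) -> (forall u, wealth X m Xh s c u w < c) ->
    (\sum_(1 <= i < t.+1) psiE `|X i w - Xh i w|%R < +oo)%E ->
  s * \sum_(1 <= i < t.+1) (X i w - m i w) -
    s ^+ 2 * fine (\sum_(1 <= i < t.+1) psiE `|X i w - Xh i w|%R)%E <= ln c.
Proof.
move=> s1 c0 m01 Wc Voo.
rewrite -ler_expR lnK ?posrE// (le_trans _ (ltW (Wc t)))// (wealth_prod t m01 Wc).
exact: (@prod_bet_ge _ s (X ^~ w) (m ^~ w) (Xh ^~ w)).
Qed.

(** Locates the epoch of [v]: [L <= v] makes the logarithm nonnegative, so its truncation is a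
    genuine integer part. *)
Lemma epoch_bounds (R : realType) (eta L v : R) :
    1 < eta -> 0 < L -> L <= v ->
    let k := Num.truncn (logb eta (v / L)) in
  k%:R <= logb eta (v / L) /\ L * eta ^+ k <= v <= eta * (L * eta ^+ k).
Proof.
move=> eta1 L0 Lv k.
have le0 : 0 < ln eta by rewrite ln_gt0.
have vL : 1 <= v / L by rewrite ler_pdivlMr// mul1r.
have eta0 : 0 < eta by lra.
have /Num.Theory.truncn_itv : 0 <= logb eta (v / L).
  by rewrite /logb divr_ge0 ?ln_ge0// ltW.
rewrite -/k => /andP[kle klt]; split=> //.
have e0 n : 0 < eta ^+ n by rewrite exprn_gt0.
move: kle klt; rewrite /logb ler_pdivlMr// ltr_pdivrMr// !mulr_natl -!lnXn//.
have vL0 : 0 < v / L by exact: lt_le_trans vL.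
rewrite ler_ln ?posrE// ltr_ln ?posrE//.
rewrite ler_pdivlMr// ltr_pdivrMr// exprS => kle klt.
by rewrite (mulrC L) kle mulrA ltW.
Qed.

(** * Union bound over epochs and signs *)

Theorem mainTheorem6 (d : measure_display) (T : measurableType d) (R : realType)
  (P : probability T R)
  (X : nat -> T -> R) (m : nat -> T -> R) (Xhat : nat -> T -> R)
  (h : R -> R) (eta alpha L0 : R) :
  (forall i, (1 <= i)%N -> measurable_fun setT (X i)) ->
  (forall i x, (1 <= i)%N -> 0 <= X i x <= 1) ->
  (* m j is (a version of) E[X_j | F_{j-1}] *)
  (forall j, (1 <= j)%N -> is_cond_exp P (nat_filtration X j.-1) (X j) (m j)) ->
  (* Xhat predictable, with values in [0,1) *)
  (forall t, (1 <= t)%N -> measurable_wrt (nat_filtration X t.-1) (Xhat t)) ->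
  (forall t x, (1 <= t)%N -> 0 <= Xhat t x < 1) ->
  (forall x, 0 <= x -> 0 < h x) ->
  (forall x y, 0 <= x -> x <= y -> h x <= h y) ->
  (\sum_(0 <= j <oo) ((h j%:R)^-1)%:E <= 1)%E ->
  1 < eta -> 0 < alpha < 1 -> 1 <= L0 ->
  exists E : set T, [/\ measurable E, ((1 - alpha)%:E <= P E)%E &
    forall x, E x -> forall t : nat, (1 <= t)%N ->
      let Vt := (\sum_(1 <= i < t.+1) psiE `|X i x - Xhat i x|%R)%E in
      let v := fine Vt in
      (L0%:E <= Vt)%E -> (Vt < +oo)%E ->
      h (logb eta (v / L0)) <= alpha / 2 * expR v ->
      let Xbar := t%:R^-1 * \sum_(1 <= i < t.+1) X i x in
      let mu := t%:R^-1 * \sum_(1 <= j < t.+1) m j x in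
      `|Xbar - mu| <=
        (Num.sqrt eta + 1) / t%:R *
        Num.sqrt (v * (ln (2 / alpha) + ln (h (logb eta (v / L0)))))].
Proof.
move=> mX X01 Xm mXh Xh01 h0 hnd hsum eta1 /andP[a0 a1] L1.
(* A single term of the series is at most its sum. This makes every threshold [c k] exceed 1, hence
   its logarithm positive. *)
have h1 k : 1 <= h k%:R.
  have hk : 0 < h k%:R by rewrite h0// ler0n.
  rewrite -invf_le1// -lee_fin; apply: le_trans hsum.
  apply: le_trans (nneseries_lim_ge k.+1 _); last first.
    by move=> n _ _; rewrite lee_fin invr_ge0 ltW// h0// ler0n.
  rewrite big_nat_recr//= leeDr// sume_ge0// => n _.
  by rewrite lee_fin invr_ge0 ltW// h0// ler0n.
(* By Ville, each sign of the bet in epoch [k] costs probability [alpha / (2 h(k))]. *)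
pose c k := 2 * h k%:R / alpha.
pose q k := L0 * eta ^+ k.
(* The square root minimises [ln (c k) / lam + lam * q k], with [q k] the left end of the epoch;
   clipping at 1 keeps the bets nonnegative. *)
pose lam k := Num.min 1 (Num.sqrt (ln (c k) / q k)).
have c0 k : 0 < c k by rewrite divr_gt0// mulr_gt0// (lt_le_trans ltr01).
have q0 k : 0 < q k by rewrite mulr_gt0 ?exprn_gt0//; lra.
have lnc0 k : 0 < ln (c k).
  by rewrite ln_gt0// ltr_pdivlMr// mul1r; have := h1 k; lra.
have lam01 k : 0 < lam k <= 1.
  by rewrite /lam lt_min ltr01 sqrtr_gt0 divr_gt0//= ge_min lexx.
have lamp k : -1 <= lam k <= 1 by have := lam01 k; lra.
have lamn k : -1 <= - lam k <= 1 by have := lam01 k; lra.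
pose A s k := \bigcup_t [set w | c k <= wealth X m Xhat s (c k) t w].
have mA s k : -1 <= s <= 1 -> measurable (A s k).
  by move=> s1; apply: bigcup_measurable => t _; exact: (@measurable_wealth_ge _ _ _ P).
have PA s k : -1 <= s <= 1 -> (P (A s k) <= ((c k)^-1)%:E)%E.
  by move=> s1; exact: ville_wealth.
pose B k := A (lam k) k `|` A (- lam k) k.
have mB k : measurable (B k) by apply: measurableU; exact: mA.
have PB k : (P (B k) <= alpha%:E * ((h k%:R)^-1)%:E)%E.
  apply: le_trans (measureU2 P (mA _ _ (lamp k)) (mA _ _ (lamn k))) _.
  apply: le_trans (leeD (PA _ _ (lamp k)) (PA _ _ (lamn k))) _.
  rewrite -EFinD -EFinM lee_fin /c le_eqVlt; apply/orP; left; apply/eqP.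
  by field; rewrite !gt_eqF// (lt_le_trans ltr01).
(* Off the null set [N] the wealth is never stopped because of a conditional mean; off every [B k]
   it never reaches its threshold. *)
have [N [mN N0 mN01]] : {ae P, forall x, forall j, 0 <= m j.+1 x <= 1}.
  apply: ae_foralln => j; apply: cond_exp_ge0_le1 (Xm j.+1 isT).
  - exact: nat_filtration_measurable.
  - exact: mX.
  - by move=> x; exact: X01.
have mBT : measurable (\bigcup_k B k) by apply: bigcup_measurable.
exists (~` (\bigcup_k B k `|` N)); split.
- by apply: measurableC; apply: measurableU.
- rewrite probability_setC; last exact: measurableU.
  rewrite measureU0// EFinB leeB//.
  apply: le_trans (generalized_Boole_inequality P mB mBT) _.
  (* The epoch costs [alpha / h(k)] sum to at most [alpha] by [hsum]. *)
  apply: (@le_trans _ _ (\sum_(0 <= k <oo) (alpha%:E * ((h k%:R)^-1)%:E))%E).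
    by apply: lee_nneseries => // k _; exact: PB.
  rewrite nneseriesZl; last by move=> k _; rewrite lee_fin invr_ge0 ltW// h0// ler0n.
  rewrite -[leRHS]mule1; apply: lee_wpmul2l => //.
  by rewrite lee_fin ltW.
move=> x /not_orP[xB xN] t t1 Vt v LV Voo hv; cbv zeta.
have m01 j : 0 <= m j.+1 x <= 1.
  by move: j; apply: contrapT => xm; apply: xN; exact: mN01.
have Wlt s k : ~ A s k x -> forall u, wealth X m Xhat s (c k) u x < c k.
  by move=> nA u; rewrite ltNge; apply/negP => cW; apply: nA; exists u.
have Vfin : Vt \is a fin_num.
  by rewrite fin_numElt Voo andbT (lt_le_trans _ LV)// ltNyr.
have Lv : L0 <= v by rewrite -lee_fin fineK.
have L00 : 0 < L0 by lra.
have [kl /andP[qv vq]] := epoch_bounds eta1 L00 Lv.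
set k := Num.truncn _ in kl qv vq.
set lb := logb _ _ in hv kl *.
have lb0 : 0 <= lb by rewrite (le_trans _ kl)// ler0n.
have hk0 : 0 < h k%:R by exact: lt_le_trans (h1 k).
have hl0 : 0 < h lb by exact: h0.
have hkl : h k%:R <= h lb by rewrite hnd// ler0n.
pose l := ln (2 / alpha) + ln (h lb).
have ai0 : 0 < alpha^-1 by rewrite invr_gt0.
have a20 : 0 < 2 / alpha by rewrite divr_gt0.
have lE : l = ln (2 / alpha * h lb) by rewrite lnM ?posrE.
(* As [k <= lb] and [h] is nondecreasing, the epoch's log-threshold is at most the logarithmic term
   of the claim. *)
have lncl : ln (c k) <= l.
  rewrite lE /c mulrAC ler_ln ?posrE ?mulr_gt0//.
  by rewrite ler_pM2l.
(* The condition [hv] in logarithmic form; it supplies the hypothesis [l <= v] of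
   [stitched_bound]. *)
have lv : l <= v.
  rewrite lE -[leRHS]expRK ler_ln ?posrE ?expR_gt0 ?mulr_gt0//.
  move: hv; rewrite mulrAC ler_pdivlMr// => hv.
  by rewrite mulrAC ler_pdivrMr// mulrC [leRHS]mulrC.
set S := \sum_(1 <= i < t.+1) (X i x - m i x).
(* Treats both tails at once: it is used with [S' = S], [s = lam k] and with [S' = - S],
   [s = - lam k]. *)
have bound (S' s : R) : s * S = lam k * S' -> s ^+ 2 = lam k ^+ 2 ->
    -1 <= s <= 1 -> ~ A s k x -> S' <= (Num.sqrt eta + 1) * Num.sqrt (v * l).
  move=> sS s2 s1 nA.
  have := @wealth_deviation _ _ X m Xhat s (c k) x t s1 (c0 k) m01 (Wlt _ _ nA) Voo.
  rewrite -/S sS s2 -/Vt -/v => dev.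
  apply: (@le_trans _ _ ((Num.sqrt eta + 1) * Num.sqrt (v * ln (c k)))).
    apply: (@stitched_bound _ _ _ (q k)) => //; first by rewrite qv.
    by rewrite lnc0 (le_trans lncl).
  rewrite ler_wpM2l ?addr_ge0 ?sqrtr_ge0// ler_wsqrtr// ler_wpM2l//.
  by rewrite (le_trans _ Lv)// ltW.
have nB : ~ B k x by move=> Bk; apply: xB; exists k.
have Sle : `|S| <= (Num.sqrt eta + 1) * Num.sqrt (v * l).
  rewrite ler_norml; apply/andP; split.
    rewrite lerNl; apply: (bound _ (- lam k)) => //.
    - by rewrite mulrN mulNr.
    - by rewrite sqrrN.
    - by move=> ?; apply: nB; right.
  by apply: (bound _ (lam k)) => // ?; apply: nB; left.
have t0 : 0 < t%:R :> R by rewrite ltr0n.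
rewrite -mulrBr -sumrB -/S normrM gtr0_norm ?invr_gt0//.
by rewrite mulrAC -/l [leRHS]mulrC ler_pM2l// invr_gt0.
Qed.
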